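(* Let $\bar z\in\mathbb R^n$ be a feasible point of (P) and fix $\bar\lambda\in K(\bar z)$. Assume that $\mathfrak H_M$ is metrically subregular at $((\bar z,\bar\lambda),((0,0),(0,0,0),0))$. Then $\mathcal H_M$ is metrically subregular at $((\bar z,\bar\lambda),(0,0,0))$.
   Context: Let $f\colon\mathbb R^n\to\mathbb R$ be locally Lipschitz continuous, let $F\colon\mathbb R^n\rightrightarrows\mathbb R^m$ and $G\colon\mathbb R^n\times\mathbb R^m\rightrightarrows\mathbb R^s$ be set-valued mappings with closed graphs, and let $M\subset\mathbb R^n$ be nonempty and closed. Set $H(z):=\bigcup_{\lambda\in F(z)}G(z,\lambda)$; it is assumed that $\operatorname{gph}H$ is (locally) closed. Problem (P): minimize $f(z)$ over $z\in\mathbb R^n$ subject to $0\in H(z)$, $z\in M$. Put $K(z):=\{\lambda\in F(z)\mid 0\in G(z,\lambda)\}$. Auxiliary mappings: $\mathcal H_M(z,\lambda):=(F(z)-\lambda)\times G(z,\lambda)\times(z-M)$ and $\mathfrak H_M(z,\lambda):=\big((z,\lambda)-\operatorname{gph}F\big)\times\big((z,\lambda,0)-\operatorname{gph}G\big)\times(z-M)$. Products carry the sum of Euclidean norms; $\operatorname{dist}(z,A)=\inf_{a\in A}\|a-z\|$ ($=+\infty$ if $A=\varnothing$). A set-valued mapping $\Upsilon$ is metrically subregular at $(\bar z,\bar w)\in\operatorname{gph}\Upsilon$ if there are $\kappa>0$ and a neighborhood $U$ of $\bar z$ with $\operatorname{dist}(z,\Upsilon^{-1}(\bar w))\le\kappa\operatorname{dist}(\bar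 w,\Upsilon(z))$ for all $z\in U$, where $\Upsilon^{-1}(w)=\{z\mid w\in\Upsilon(z)\}$. *)

(* Defs.v *)
From HB Require Import structures.
From mathcomp Require Import all_boot all_order all_algebra.
From mathcomp Require Import all_classical all_reals all_analysis.

Set Implicit Arguments.
Unset Strict Implicit.
Unset Printing Implicit Defensive.

Import Order.TTheory GRing.Theory Num.Theory.
Import numFieldNormedType.Exports.

Local Open Scope classical_set_scope.
Local Open Scope ring_scope.

(* The library's norms on row vectors and on pairs are maximum norms, so the
   Euclidean norm is defined here, and distances are passed explicitly: the
   Euclidean one on each factor, and on products their sum, which is the
   distance of the sum of the Euclidean norms.  These distances induce the
   library topologies, which are used for closedness and neighbourhoods. *)
Definition euclidean_norm {R : realType} {n : nat} (x : 'rV[R]_n) : R :=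
  Num.sqrt (\sum_(i < n) x ord0 i ^+ 2).

Definition euclidean_dist {R : realType} {n : nat} (x y : 'rV[R]_n) : R :=
  euclidean_norm (x - y).

Definition sum_dist {R : realType} {X Y : Type} (dX : X -> X -> R)
    (dY : Y -> Y -> R) (p q : X * Y) : R :=
  dX p.1 q.1 + dY p.2 q.2.

Definition dist_to_set {R : realType} {X : Type} (dX : X -> X -> R) (x : X)
    (A : set X) : \bar R :=
  ereal_inf [set (dX a x)%:E | a in A].

Definition gph {X Y : Type} (U : X -> set Y) : set (X * Y) :=
  [set p | U p.1 p.2].

Definition inverse_mapping {X Y : Type} (U : X -> set Y) : Y -> set X :=
  fun y => [set x | U x y].

Definition metrically_subregular {R : realType} {X : topologicalType}
    {Y : Type} (dX : X -> X -> R) (dY : Y -> Y -> R) (U : X -> set Y)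
    (x0 : X) (y0 : Y) : Prop :=
  gph U (x0, y0) /\
  exists kappa : R, 0 < kappa /\
    exists V : set X, nbhs x0 V /\
      forall x : X, V x ->
        (dist_to_set dX x (inverse_mapping U y0)
          <= kappa%:E * dist_to_set dY y0 (U x))%E.

Definition locally_lipschitz {R : realType} {n : nat} (f : 'rV[R]_n -> R) :
    Prop :=
  forall x : 'rV[R]_n, exists L : R, exists V : set 'rV[R]_n, nbhs x V /\
    forall y z : 'rV[R]_n, V y -> V z ->
      `|f y - f z| <= L * euclidean_norm (y - z).

Definition locally_closed {T : topologicalType} (A : set T) : Prop :=
  forall x : T, A x ->
    exists V : set T, [/\ nbhs x V, closed V & closed (A `&` V)].

Section Problem.

Context {R : realType} {n m s : nat}.

Notation Rn := 'rV[R]_n.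
Notation Rm := 'rV[R]_m.
Notation Rs := 'rV[R]_s.

Variables (F : Rn -> set Rm) (G : Rn * Rm -> set Rs) (M : set Rn).

Definition H_map (z : Rn) : set Rs := \bigcup_(l in F z) G (z, l).

Definition K_map (z : Rn) : set Rm := [set l | F z l /\ G (z, l) 0].

Definition feasible (z : Rn) : Prop := H_map z 0 /\ M z.

Definition calH_M (zl : Rn * Rm) : set (Rm * Rs * Rn) :=
  [set y - zl.2 | y in F zl.1] `*` G zl `*` [set zl.1 - x | x in M].

Definition frakH_M (zl : Rn * Rm) : set ((Rn * Rm) * (Rn * Rm * Rs) * Rn) :=
  [set zl - p | p in gph F] `*` [set (zl, 0) - q | q in gph G]
    `*` [set zl.1 - x | x in M].

End Problem.

(* Main.v *)
(* The two residual maps vanish at the same points, and every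
   [w = (y - l, g, z - x)] in [calH_M F G M (z, l)] is matched by
   [((z, l) - (z, y), (z, l, 0) - (z, l, g), z - x)] in [frakH_M F G M (z, l)],
   which has the same norm.  Hence the residual of [frakH_M] never exceeds that
   of [calH_M]. *)

Require Import Defs.
From HB Require Import structures.
From mathcomp Require Import all_boot all_order all_algebra.
From mathcomp Require Import all_classical all_reals all_analysis.

Set Implicit Arguments.
Unset Strict Implicit.
Unset Printing Implicit Defensive.

Import Order.TTheory GRing.Theory Num.Theory.
Import numFieldNormedType.Exports.

Local Open Scope classical_set_scope.
Local Open Scope ring_scope.

Lemma euclidean_normN (R : realType) (n : nat) (x : 'rV[R]_n) :
  euclidean_norm (- x) = euclidean_norm x.
Proof.
by congr Num.sqrt; apply: eq_bigr => i _; rewrite mxE sqrrN.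
Qed.

Lemma euclidean_distxx (R : realType) (n : nat) (x : 'rV[R]_n) :
  euclidean_dist x x = 0.
Proof.
rewrite /euclidean_dist subrr /euclidean_norm big1 ?sqrtr0// => i _.
by rewrite mxE expr0n.
Qed.

(** Each competitor in the right-hand infimum dominates one in the left-hand infimum; if [B] is
    empty, the right-hand side is [+oo]. This serves both for residuals in different product spaces
    and for distances to two nested zero sets. *)
Lemma le_dist_to_set (R : realType) (X Y : Type) (dX : X -> X -> R)
    (dY : Y -> Y -> R) (x : X) (y : Y) (A : set X) (B : set Y) :
  (forall b, B b -> exists2 a, A a & dX a x <= dY b y) ->
  (dist_to_set dX x A <= dist_to_set dY y B)%E.
Proof.
move=> AB; apply: le_ereal_inf_tmp => _ [b Bb <-].
have [a Aa leab] := AB b Bb.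
by apply: (@le_trans _ _ (dX a x)%:E); [apply: ereal_inf_lbound; exists a|].
Qed.

Section ResidualMaps.

Context {R : realType} {n m s : nat}.
Variables (F : 'rV[R]_n -> set 'rV[R]_m).
Variables (G : 'rV[R]_n * 'rV[R]_m -> set 'rV[R]_s) (M : set 'rV[R]_n).

Lemma calH_M0 (z : 'rV[R]_n) (l : 'rV[R]_m) :
  K_map F G z l -> M z -> calH_M F G M (z, l) (0, 0, 0).
Proof.
by move=> [Fzl Gzl] Mz; split; [split=> //=; exists l|exists z];
  rewrite ?subrr.
Qed.

(** A zero in every block forces the chosen points of [gph F], [gph G] and [M] to be [(z, l)],
    [(z, l, 0)] and [z]. *)
Lemma frakH_M0 (z : 'rV[R]_n) (l : 'rV[R]_m) :
  frakH_M F G M (z, l) ((0, 0), (0, 0, 0), 0) -> K_map F G z l /\ M z.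
Proof.
case=> -[] /= [[z1 l1] /= Fz1 [/subr0_eq ez1 /subr0_eq el1]].
move=> [[[z2 l2] g] /= Gz2 [/subr0_eq ez2 /subr0_eq el2 /subr0_eq eg]].
move=> [x Mx /subr0_eq ex]; subst; by [].
Qed.

Lemma frakH_M_residual_le (zl : 'rV[R]_n * 'rV[R]_m) :
  (dist_to_set
     (sum_dist
       (sum_dist
         (sum_dist (@euclidean_dist R n) (@euclidean_dist R m))
         (sum_dist (sum_dist (@euclidean_dist R n) (@euclidean_dist R m))
           (@euclidean_dist R s)))
       (@euclidean_dist R n))
     ((0, 0), (0, 0, 0), 0)%R (frakH_M F G M zl)
   <= dist_to_set
     (sum_dist (sum_dist (@euclidean_dist R m) (@euclidean_dist R s))
       (@euclidean_dist R n))
     (0, 0, 0)%R (calH_M F G M zl))%E.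
Proof.
case: zl => z l; apply: le_dist_to_set.
move=> [[_ g] _] [[/= [y Fy <-] Gg] [x Mx <-]].
exists ((0, l - y), (0, 0, - g), z - x).
  split; last by exists x.
  split; first by exists (z, y) => //; congr pair; rewrite /= subrr.
  exists ((z, l), g) => //.
  by congr pair; [congr pair; rewrite /= subrr|rewrite /= sub0r].
(* The zero blocks contribute nothing; the sign changes [l - y] against [y - l] and [- g] against
   [g] disappear because the norm is even. *)
rewrite /sum_dist /= !euclidean_distxx !add0r.
by rewrite /euclidean_dist !subr0 euclidean_normN -(opprB y) euclidean_normN.
Qed.

End ResidualMaps.

Theorem proposition4p14 (R : realType) (n m s : nat)
  (f : 'rV[R]_n -> R)
  (F : 'rV[R]_n -> set 'rV[R]_m)
  (G : 'rV[R]_n * 'rV[R]_m -> set 'rV[R]_s)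
  (M : set 'rV[R]_n)
  (f_lip : locally_lipschitz f)
  (F_closed : closed (gph F))
  (G_closed : closed (gph G))
  (M_nonempty : M !=set0)
  (M_closed : closed M)
  (H_closed : locally_closed (gph (H_map F G)))
  (zbar : 'rV[R]_n) (zbar_feasible : feasible F G M zbar)
  (lbar : 'rV[R]_m) (lbar_K : K_map F G zbar lbar)
  (frakH_subregular :
    metrically_subregular
      (sum_dist (@euclidean_dist R n) (@euclidean_dist R m))
      (sum_dist
        (sum_dist
          (sum_dist (@euclidean_dist R n) (@euclidean_dist R m))
          (sum_dist (sum_dist (@euclidean_dist R n) (@euclidean_dist R m))
            (@euclidean_dist R s)))
        (@euclidean_dist R n))
      (frakH_M F G M) (zbar, lbar) ((0, 0), (0, 0, 0), 0)) :
  metrically_subregular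
    (sum_dist (@euclidean_dist R n) (@euclidean_dist R m))
    (sum_dist (sum_dist (@euclidean_dist R m) (@euclidean_dist R s))
      (@euclidean_dist R n))
    (calH_M F G M) (zbar, lbar) (0, 0, 0).
Proof.
have [_ [kappa [kappa_gt0 [V [nV subregV]]]]] := frakH_subregular.
split; first exact: calH_M0 lbar_K zbar_feasible.2.
(* Constant and neighbourhood carry over unchanged. *)
exists kappa; split=> //; exists V; split=> // zl Vzl.
apply: (le_trans _ (le_trans (subregV _ Vzl) _)).
  (* Zeros of [frakH_M] are zeros of [calH_M], and the distance to a larger set is smaller. *)
  apply: le_dist_to_set => -[z l] /frakH_M0[Kzl Mz].
  by exists (z, l) => //; exact: calH_M0.
(* Scaling by [kappa] is monotone in the extended reals, so this also covers an empty [F z] or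
   [G (z, l)], where the residual of [calH_M] is [+oo]. *)
by rewrite lee_wpmul2l ?lee_fin ?(ltW kappa_gt0)// frakH_M_residual_le.
Qed.
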